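(* For each of the five groups $H\in\{G,\tilde G,\Gamma,\overline\Gamma,\overline{\overline\Gamma}\}$ and every $n\in\mathbb N$, the pair $(H,P_n)$ is a Gelfand pair, where $P_n<H$ is the stabilizer of the level-$n$ vertex of the ray $1^\infty$ (for $G$, $\tilde G$), respectively $2^\infty$ (for $\Gamma,\overline\Gamma,\overline{\overline\Gamma}$).
   Context: The rooted trees are $\mathcal T_d=\{0,\dots,d-1\}^*$ for $d=2,3$; automorphisms act on the left on finite words. For a letter $x$ let $\overline x=x+1\bmod d$ and $\overline{\overline x}=x+2\bmod d$; $a$ is the automorphism $a(x\sigma)=\overline x\sigma$. All other generators below fix the first level pointwise and are defined recursively. $G=\langle a,b,c,d\rangle<\operatorname{Aut}(\mathcal T_2)$: $b(0x\sigma)=0\overline x\sigma$, $b(1\sigma)=1c(\sigma)$; $c(0x\sigma)=0\overline x\sigma$, $c(1\sigma)=1d(\sigma)$; $d(0x\sigma)=0x\sigma$, $d(1\sigma)=1b(\sigma)$. $\tilde G=\langle a,\tilde b,\tilde c,\tilde d\rangle<\operatorname{Aut}(\mathcal T_2)$: $\tilde b(0x\sigma)=0\overline x\sigma$, $\tilde b(1\sigma)=1\tilde c(\sigma)$; $\tilde c(0\sigma)=0\sigma$, $\tilde c(1\sigma)=1\tilde d(\sigma)$; $\tilde d(0\sigma)=0\sigma$, $\tilde d(1\sigma)=1\tilde b(\sigma)$. $\Gamma$, $\overline\Gamma$, $\overline{\overline\Gamma}$ are the subgroups $\langle a,t\rangle$ of $\operatorname{Aut}(\mathcal T_3)$ where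 $t(0x\sigma)=0\overline x\sigma$, $t(2\sigma)=2t(\sigma)$ and respectively $t(1x\sigma)=1x\sigma$ (for $\Gamma$), $t(1x\sigma)=1\overline x\sigma$ (for $\overline\Gamma$), $t(1x\sigma)=1\overline{\overline x}\sigma$ (for $\overline{\overline\Gamma}$). A pair $(H,Q)$ of a group and a subgroup is a Gelfand pair if all irreducible subrepresentations of the quasi-regular representation $\rho_{H/Q}$ of $H$ on $\ell^2(H/Q)$ (complex coefficients) have multiplicity $1$. *)

(* Defs.v *)
From HB Require Import structures.
From mathcomp Require Import all_boot all_order all_algebra.
From mathcomp Require Import monoid complex.
From mathcomp Require Import boolp classical_sets functions reals ereal esum.
From mathcomp Require Import numfun.

Set Implicit Arguments.
Unset Strict Implicit.
Unset Printing Implicit Defensive.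

Import Order.TTheory GRing.Theory Num.Theory.
Local Open Scope classical_set_scope.
Local Open Scope ring_scope.
Local Open Scope complex_scope.

Definition is_subgroup (gT : groupType) (K : set gT) : Prop :=
  group_closed (mem K).

Definition generated (gT : groupType) (S : set gT) : set gT :=
  smallest (@is_subgroup gT) S.

Definition lmul (gT : groupType) (h : gT) (A : set gT) : set gT :=
  [set (h * x)%g | x in A].

Definition lcosets (gT : groupType) (H Q : set gT) : set (set gT) :=
  [set lmul h Q | h in H].

Section Gelfand.
Variables (R : realType) (gT : groupType).
Local Notation C := R[i].

(* A function on H/Q is encoded as a function on all subsets of the ambient
   group that vanishes outside of lcosets H Q. *)
Local Notation fn := (set gT -> C).
Implicit Types (H Q : set gT) (f g : fn) (V W : set fn).

(* Meaningful only for absolutely summable u, as is the case in dotprod for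
   f and g in ell2. *)
Definition abs_sum (D : set (set gT)) (u : set gT -> R) : R :=
  fine (\esum_(x in D) (EFin \o u)^\+ x
        - \esum_(x in D) (EFin \o u)^\- x)%E.

Definition sqnorm H Q f : \bar R :=
  \esum_(x in lcosets H Q) ((complex.Re (f x)) ^+ 2 + (complex.Im (f x)) ^+ 2)%:E.

Definition dotprod H Q f g : C :=
  abs_sum (lcosets H Q) (fun x => complex.Re (f x * (g x)^*))
  +i* abs_sum (lcosets H Q) (fun x => complex.Im (f x * (g x)^*)).

Definition ell2 H Q : set fn :=
  [set f | (forall x, ~ lcosets H Q x -> f x = 0) /\ (sqnorm H Q f < +oo)%E].

Definition quasi_regular (h : gT) f : fn := fun x => f (lmul h^-1%g x).

Definition linear_subspace W : Prop :=
  W (fun=> 0) /\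
  forall (z : C) f g, W f -> W g -> W (fun x => z * f x + g x).

Definition ell2_closed H Q W : Prop :=
  forall f, ell2 H Q f ->
    (forall e : R, 0 < e ->
      exists2 g, W g & (sqnorm H Q (fun x => f x - g x)%R < e%:E)%E) ->
    W f.

Definition subrep H Q W : Prop :=
  [/\ W `<=` ell2 H Q, linear_subspace W, ell2_closed H Q W &
      forall h f, H h -> W f -> W (quasi_regular h f)].

Definition irreducible_subrep H Q V : Prop :=
  [/\ subrep H Q V, V <> [set fun=> 0] &
      forall W, subrep H Q W -> W `<=` V -> W = [set fun=> 0] \/ W = V].

(* The intertwiner U, linear and isometric from V onto W, is unitary; its values
   outside of V are irrelevant. *)
Definition equivalent_subreps H Q V W : Prop :=
  exists U : fn -> fn,
    [/\ U @` V = W,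
        (forall (z : C) f g, V f -> V g ->
           U (fun x => z * f x + g x) = (fun x => z * U f x + U g x)),
        (forall f, V f -> sqnorm H Q (U f) = sqnorm H Q f) &
        (forall h f, H h -> V f ->
           U (quasi_regular h f) = quasi_regular h (U f))].

Definition orthogonal_subspaces H Q V W : Prop :=
  forall f g, V f -> W g -> dotprod H Q f g = 0.

(* The multiplicity of V is the largest number of pairwise orthogonal
   subrepresentations equivalent to V. *)
Definition contains_copies H Q V (k : nat) : Prop :=
  exists W : 'I_k -> set fn,
    [/\ (forall i, subrep H Q (W i)),
        (forall i, equivalent_subreps H Q V (W i)) &
        (forall i j, i != j -> orthogonal_subspaces H Q (W i) (W j))].

Definition has_multiplicity H Q V (k : nat) : Prop :=
  contains_copies H Q V k /\ ~ contains_copies H Q V k.+1.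

Definition gelfand_pair H Q : Prop :=
  [/\ is_subgroup H, is_subgroup Q, Q `<=` H &
      forall V, irreducible_subrep H Q V -> has_multiplicity H Q V 1].

End Gelfand.

Arguments gelfand_pair R {gT} H Q.

Definition word (d : nat) : Type := seq 'I_d.

(* Automorphisms of the rooted tree of words are the bijections preserving and
   reflecting the prefix order. *)
Record tree_aut (d : nat) : Type := TreeAut {
  aut_fun :> word d -> word d;
  aut_inv : word d -> word d;
  aut_funK : cancel aut_fun aut_inv;
  aut_invK : cancel aut_inv aut_fun;
  aut_prefix : {mono aut_fun : u v / prefix u v} }.

Section TreeAutGroup.
Variable d : nat.
Implicit Types g h k : tree_aut d.

Lemma tree_aut_eq g h : aut_fun g =1 aut_fun h -> g = h.
Proof.
case: g h => [f f' fK f'K fP] [k k' kK k'K kP] /= /funext e.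
subst k; have e' : f' = k' by apply/funext => w; rewrite -{1}(k'K w) fK.
by subst k'; congr TreeAut; apply: Prop_irrelevance.
Qed.

Lemma aut_one_prefix : {mono (@id (word d)) : u v / prefix u v}.
Proof. by []. Qed.

Definition aut_one : tree_aut d :=
  @TreeAut d id id (fun=> erefl) (fun=> erefl) aut_one_prefix.

Lemma aut_mul_prefix g h : {mono g \o h : u v / prefix u v}.
Proof. by move=> u v /=; rewrite !aut_prefix. Qed.

Definition aut_mul g h : tree_aut d :=
  @TreeAut d (g \o h) (aut_inv h \o aut_inv g)
          (can_comp (@aut_funK d g) (@aut_funK d h))
          (can_comp (@aut_invK d h) (@aut_invK d g)) (@aut_mul_prefix g h).

Lemma aut_inv_prefix g : {mono aut_inv g : u v / prefix u v}.
Proof. by move=> u v; rewrite -(aut_prefix g) !aut_invK. Qed.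

Definition aut_V g : tree_aut d :=
  TreeAut (@aut_invK d g) (@aut_funK d g) (@aut_inv_prefix g).

Lemma aut_mulA : associative aut_mul.
Proof. by move=> g h k; apply: tree_aut_eq. Qed.

Lemma aut_mul1g : left_id aut_one aut_mul.
Proof. by move=> g; apply: tree_aut_eq. Qed.

Lemma aut_mulg1 : right_id aut_one aut_mul.
Proof. by move=> g; apply: tree_aut_eq. Qed.

Lemma aut_mulVg : left_inverse aut_one aut_V aut_mul.
Proof. by move=> g; apply: tree_aut_eq => w /=; rewrite aut_funK. Qed.

Lemma aut_mulgV : right_inverse aut_one aut_V aut_mul.
Proof. by move=> g; apply: tree_aut_eq => w /=; rewrite aut_invK. Qed.

End TreeAutGroup.

HB.instance Definition _ (d : nat) := gen_eqMixin (tree_aut d).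
HB.instance Definition _ (d : nat) := gen_choiceMixin (tree_aut d).
HB.instance Definition _ (d : nat) :=
  isGroup.Build (tree_aut d) (@aut_mulA d) (@aut_mul1g d) (@aut_mulg1 d)
    (@aut_mulVg d) (@aut_mulgV d).

Lemma homo_prefix_mono d (f f' : word d -> word d) : cancel f f' ->
  {homo f : u v / prefix u v} -> {homo f' : u v / prefix u v} ->
  {mono f : u v / prefix u v}.
Proof.
by move=> fK fP f'P u v; apply/idP/idP => [/f'P|/fP //]; rewrite !fK.
Qed.

Definition level_stabilizer d (H : set (tree_aut d)) (x : 'I_d) (n : nat) :
    set (tree_aut d) :=
  [set g | H g /\ g (nseq n x) = nseq n x].

Definition a_fun d (w : word d) : word d :=
  if w is x :: s then ordS x :: s else [::].

Definition a_inv d (w : word d) : word d :=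
  if w is x :: s then ord_pred x :: s else [::].

Lemma a_funK d : cancel (@a_fun d) (@a_inv d).
Proof. by case=> //= x s; rewrite ordSK. Qed.

Lemma a_invK d : cancel (@a_inv d) (@a_fun d).
Proof. by case=> //= x s; rewrite ord_predK. Qed.

Lemma a_fun_homo d : {homo @a_fun d : u v / prefix u v}.
Proof. by case=> [|x u] [|y v] //= /andP[/eqP-> ->]; rewrite eqxx. Qed.

Lemma a_inv_homo d : {homo @a_inv d : u v / prefix u v}.
Proof. by case=> [|x u] [|y v] //= /andP[/eqP-> ->]; rewrite eqxx. Qed.

Definition aut_a d : tree_aut d :=
  TreeAut (@a_funK d) (@a_invK d)
    (homo_prefix_mono (@a_funK d) (@a_fun_homo d) (@a_inv_homo d)).

Lemma a_fun2K : involutive (@a_fun 2).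
Proof.
by case=> //= x s; congr cons; apply: val_inj; case: x => [[|[|[]]]].
Qed.

(* b(0 x s) = 0 (x+1) s amounts to b(0 w) = 0 a(w), also for w empty; similarly
   for the other generators. *)
Fixpoint b_fun (w : word 2) : word 2 :=
  if w is x :: s then
    x :: (if x == ord0 then a_fun s else c_fun s)
  else [::]
with c_fun (w : word 2) : word 2 :=
  if w is x :: s then
    x :: (if x == ord0 then a_fun s else d_fun s)
  else [::]
with d_fun (w : word 2) : word 2 :=
  if w is x :: s then
    x :: (if x == ord0 then s else b_fun s)
  else [::].

Fixpoint bt_fun (w : word 2) : word 2 :=
  if w is x :: s then
    x :: (if x == ord0 then a_fun s else ct_fun s)
  else [::]
with ct_fun (w : word 2) : word 2 :=
  if w is x :: s then
    x :: (if x == ord0 then s else dt_fun s)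
  else [::]
with dt_fun (w : word 2) : word 2 :=
  if w is x :: s then
    x :: (if x == ord0 then s else bt_fun s)
  else [::].

Lemma bcd_funK : [/\ involutive b_fun, involutive c_fun & involutive d_fun].
Proof.
suff h w : [/\ b_fun (b_fun w) = w, c_fun (c_fun w) = w & d_fun (d_fun w) = w].
  by split=> w; case: (h w).
elim: w => //= x s [hb hc hd].
by case: (x == ord0); rewrite ?a_fun2K ?hb ?hc ?hd.
Qed.

Lemma bcdt_funK :
  [/\ involutive bt_fun, involutive ct_fun & involutive dt_fun].
Proof.
suff h w :
    [/\ bt_fun (bt_fun w) = w, ct_fun (ct_fun w) = w & dt_fun (dt_fun w) = w].
  by split=> w; case: (h w).
elim: w => //= x s [hb hc hd].
by case: (x == ord0); rewrite ?a_fun2K ?hb ?hc ?hd.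
Qed.

Lemma bcd_fun_homo :
  [/\ {homo b_fun : u v / prefix u v}, {homo c_fun : u v / prefix u v} &
      {homo d_fun : u v / prefix u v}].
Proof.
suff h u : forall v, prefix u v -> [/\ prefix (b_fun u) (b_fun v),
    prefix (c_fun u) (c_fun v) & prefix (d_fun u) (d_fun v)].
  by split=> u v /h[].
elim: u => [|x u IH] [|y v] //= /andP[/eqP<- uv]; rewrite eqxx /=.
have [hb hc hd] := IH v uv.
by case: (x == ord0); split=> //; apply: a_fun_homo.
Qed.

Lemma bcdt_fun_homo :
  [/\ {homo bt_fun : u v / prefix u v}, {homo ct_fun : u v / prefix u v} &
      {homo dt_fun : u v / prefix u v}].
Proof.
suff h u : forall v, prefix u v -> [/\ prefix (bt_fun u) (bt_fun v),
    prefix (ct_fun u) (ct_fun v) & prefix (dt_fun u) (dt_fun v)].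
  by split=> u v /h[].
elim: u => [|x u IH] [|y v] //= /andP[/eqP<- uv]; rewrite eqxx /=.
have [hb hc hd] := IH v uv.
by case: (x == ord0); split=> //; apply: a_fun_homo.
Qed.

Definition involutive_aut d (f : word d -> word d) (fK : involutive f)
    (fP : {homo f : u v / prefix u v}) : tree_aut d :=
  TreeAut fK fK (homo_prefix_mono fK fP fP).

Definition aut_b := involutive_aut (let: And3 k _ _ := bcd_funK in k)
  (let: And3 p _ _ := bcd_fun_homo in p).
Definition aut_c := involutive_aut (let: And3 _ k _ := bcd_funK in k)
  (let: And3 _ p _ := bcd_fun_homo in p).
Definition aut_d := involutive_aut (let: And3 _ _ k := bcd_funK in k)
  (let: And3 _ _ p := bcd_fun_homo in p).

Definition aut_bt := involutive_aut (let: And3 k _ _ := bcdt_funK in k)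
  (let: And3 p _ _ := bcdt_fun_homo in p).
Definition aut_ct := involutive_aut (let: And3 _ k _ := bcdt_funK in k)
  (let: And3 _ p _ := bcdt_fun_homo in p).
Definition aut_dt := involutive_aut (let: And3 _ _ k := bcdt_funK in k)
  (let: And3 _ _ p := bcdt_fun_homo in p).

(* The parameter e is the power of a by which t acts below the vertex 1:
   0, 1, 2 for Gamma, Gamma-bar, Gamma-bar-bar respectively. *)
Fixpoint t_fun (e : nat) (w : word 3) : word 3 :=
  if w is x :: s then
    x :: (match val x with
          | 0%N => a_fun s
          | 1%N => iter e (@a_fun 3) s
          | _ => t_fun e s
          end)
  else [::].

Fixpoint t_inv (e : nat) (w : word 3) : word 3 :=
  if w is x :: s then
    x :: (match val x with
          | 0%N => a_inv s
          | 1%N => iter e (@a_inv 3) s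
          | _ => t_inv e s
          end)
  else [::].

Lemma iter_can (T : Type) (f f' : T -> T) e :
  cancel f f' -> cancel (iter e f) (iter e f').
Proof. by move=> fK; elim: e => // e IH x; rewrite iterSr /= fK IH. Qed.

Lemma t_funK e : cancel (t_fun e) (t_inv e).
Proof.
elim=> //= x s IH; congr cons.
by case: (nat_of_ord x) => [|[|_]] //; rewrite ?a_funK // iter_can //; apply: a_funK.
Qed.

Lemma t_invK e : cancel (t_inv e) (t_fun e).
Proof.
elim=> //= x s IH; congr cons.
by case: (nat_of_ord x) => [|[|_]] //; rewrite ?a_invK // iter_can //; apply: a_invK.
Qed.

Lemma iter_homo_prefix d (f : word d -> word d) e :
  {homo f : u v / prefix u v} -> {homo iter e f : u v / prefix u v}.
Proof. by move=> fP; elim: e => // e IH u v /IH/fP. Qed.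

Lemma t_fun_homo e : {homo t_fun e : u v / prefix u v}.
Proof.
elim=> [|x u IH] [|y v] //= /andP[/eqP<- uv]; rewrite eqxx /=.
case: (nat_of_ord x) => [|[|_]]; [exact: a_fun_homo| |exact: IH].
exact: (iter_homo_prefix e (@a_fun_homo 3) uv).
Qed.

Lemma t_inv_homo e : {homo t_inv e : u v / prefix u v}.
Proof.
elim=> [|x u IH] [|y v] //= /andP[/eqP<- uv]; rewrite eqxx /=.
case: (nat_of_ord x) => [|[|_]]; [exact: a_inv_homo| |exact: IH].
exact: (iter_homo_prefix e (@a_inv_homo 3) uv).
Qed.

Definition aut_t (e : nat) : tree_aut 3 :=
  TreeAut (@t_funK e) (@t_invK e)
    (homo_prefix_mono (@t_funK e) (@t_fun_homo e) (@t_inv_homo e)).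

Definition G_group : set (tree_aut 2) :=
  generated [set aut_a 2; aut_b; aut_c; aut_d].

Definition Gtilde_group : set (tree_aut 2) :=
  generated [set aut_a 2; aut_bt; aut_ct; aut_dt].

Definition Gamma_group : set (tree_aut 3) := generated [set aut_a 3; aut_t 0].

Definition Gammabar_group : set (tree_aut 3) :=
  generated [set aut_a 3; aut_t 1].

Definition Gammabarbar_group : set (tree_aut 3) :=
  generated [set aut_a 3; aut_t 2].

(* Main.v *)
Require Import Defs.
From mathcomp Require Import all_boot all_order all_algebra.
From mathcomp Require Import monoid complex.
From mathcomp Require Import boolp classical_sets cardinality reals.
From mathcomp Require Import ereal esum fsbigop numfun.

(** Let H act transitively on a finite set X = H/Q. Suppose that a bijection theta
   of X is such that every pair (u, v) is carried to (theta v, theta u) by some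
   element of H. Then substituting theta in an H-invariant kernel on X transposes
   it. Substitution respects products and transposition reverses them, so the
   invariant kernels commute (kernel_mulC). This rules out multiplicities above 1:
   were f0 in W0 and f1 in W1 the images of a vector f under equivalences of V
   with orthogonal subrepresentations W0 and W1, the average over H of the rank-one operator <., f0> f1 would be an invariant
   operator M, mapping into W1, whose adjoint maps into W0. Since M commutes with
   its adjoint, M = 0 (orthogonal_average_eq0); carried from W1 to W0, this says
   that the average of <., f0> f0 is 0, so f0 = 0 and V = 0.

   For the five groups, X is the level n of the tree of words over Z/d. All the
   groups permute the children of each vertex by powers of a d-cycle, so the place
   at which two words u and v diverge and the difference of the letters there are
   invariants of the pair. They are complete (whence theta, the negation of
   letters) as soon as the stabiliser of the ray is transitive on the words that
   leave the ray at a given place with a given letter (sphere_transitive).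
   Every element of H is the section of an element of H at the first vertex of
   the ray, so it suffices to treat words leaving the ray at once. For these
   one exhibits, for each letter y outside the ray, elements of the ray stabiliser
   whose sections at y generate a group that contains a and whose sections at
   some further letter exhaust H. *)

Set Implicit Arguments.
Unset Strict Implicit.
Unset Printing Implicit Defensive.

Import Order.TTheory GRing.Theory Num.Theory.
Local Open Scope classical_set_scope.
Local Open Scope ring_scope.
Local Open Scope complex_scope.

(** * Subgroups *)

Section Subgroups.
Variable gT : groupType.
Implicit Types (K : set gT) (g h : gT).

Lemma subgroup1 K : is_subgroup K -> K 1%g.
Proof. by case=> + _; rewrite inE. Qed.

Lemma subgroupV K g : is_subgroup K -> K g -> K g^-1%g.
Proof.
by move=> sK Kg; have := group_closedV sK; move/(_ g); rewrite !inE; apply.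
Qed.

Lemma subgroupM K g h : is_subgroup K -> K g -> K h -> K (g * h)%g.
Proof.
move=> sK Kg Kh; have := group_closedM sK; move/(_ g h).
by rewrite !inE; apply.
Qed.

Lemma subgroupP K : K 1%g -> (forall g, K g -> K g^-1%g) ->
  (forall g h, K g -> K h -> K (g * h)%g) -> is_subgroup K.
Proof.
move=> K1 KV KM; split; first by rewrite inE.
by move=> g h; rewrite !inE => Kg Kh; apply: KM => //; apply: KV.
Qed.

Lemma generated_subgroup (S : set gT) : is_subgroup (generated S).
Proof.
apply: subgroupP => [A [sA _]|g Sg A [sA SA]|g h Sg Sh A [sA SA]].
- exact: subgroup1.
- by apply: subgroupV => //; apply: Sg.
- by apply: subgroupM => //; [apply: Sg|apply: Sh].
Qed.

Lemma sub_generated (S : set gT) : S `<=` generated S.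
Proof. by move=> g Sg A [_]; apply. Qed.

Lemma generated_sub (S : set gT) K :
  is_subgroup K -> S `<=` K -> generated S `<=` K.
Proof. by move=> sK SK g; apply. Qed.

End Subgroups.

(** * Linear combinations of functions on cosets *)

Section LinearCombinations.
Variables (R : realType) (gT : groupType).
Local Notation C := R[i].
Local Notation fn := (set gT -> C).
Implicit Types (W : set fn).

Definition lincomb (I : Type) (s : seq I) (P : pred I) (z : I -> C)
    (F : I -> fn) : fn :=
  fun x => \sum_(i <- s | P i) z i * F i x.

Lemma lincomb_subspace W I (s : seq I) (P : pred I) z F :
  linear_subspace W -> (forall i, P i -> W (F i)) -> W (lincomb s P z F).
Proof.
move=> [W0 WD] WF; elim: s => [|i s IH].
  suff -> : lincomb [::] P z F = (fun=> 0) by [].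
  by apply/funext => x; rewrite /lincomb big_nil.
case Pi: (P i); last first.
  suff -> : lincomb (i :: s) P z F = lincomb s P z F by [].
  by apply/funext => x; rewrite /lincomb big_cons Pi.
suff -> : lincomb (i :: s) P z F = (fun x => z i * F i x + lincomb s P z F x).
  by apply: WD => //; apply: WF.
by apply/funext => x; rewrite /lincomb big_cons Pi.
Qed.

Lemma lincomb_linear W (U : fn -> fn) I (s : seq I) (P : pred I) z F :
  linear_subspace W ->
  (forall (z : C) f g, W f -> W g ->
     U (fun x => z * f x + g x) = (fun x => z * U f x + U g x)) ->
  (forall i, P i -> W (F i)) ->
  U (lincomb s P z F) = lincomb s P z (U \o F).
Proof.
move=> sW UD WF.
have U0 : U (fun=> 0) = (fun=> 0).
  have := UD (-1) _ _ sW.1 sW.1.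
  have -> : (fun x : set gT => -1 * 0 + 0 : C) = (fun=> 0).
    by apply/funext => x; rewrite mulr0 addr0.
  by move=> ->; apply/funext => x; rewrite mulN1r addNr.
elim: s => [|i s IH].
  suff [-> ->] : lincomb [::] P z F = (fun=> 0) /\
      lincomb [::] P z (U \o F) = (fun=> 0) by [].
  by split; apply/funext => x; rewrite /lincomb big_nil.
case Pi: (P i); last first.
  suff [-> ->] : lincomb (i :: s) P z F = lincomb s P z F /\
      lincomb (i :: s) P z (U \o F) = lincomb s P z (U \o F) by [].
  by split; apply/funext => x; rewrite /lincomb big_cons Pi.
have -> : lincomb (i :: s) P z F = (fun x => z i * F i x + lincomb s P z F x).
  by apply/funext => x; rewrite /lincomb big_cons Pi.
rewrite UD ?IH; [|exact: WF|exact: lincomb_subspace].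
by apply/funext => x; rewrite /lincomb big_cons Pi.
Qed.

End LinearCombinations.

(** * Gelfand's trick for a transitive action on a finite set *)

Section GelfandTrick.
Variables (R : realType) (gT : groupType) (X : finType).
Local Notation C := R[i].
Local Notation fn := (set gT -> C).
Variables (act : gT -> X -> X) (H Q : set gT) (x0 : X) (theta : X -> X).
Hypothesis act1 : forall x, act 1%g x = x.
Hypothesis actM : forall g h x, act (g * h)%g x = act g (act h x).
Hypothesis sH : is_subgroup H.
Hypothesis QE : Q = [set h | H h /\ act h x0 = x0].
Hypothesis trH : forall v, exists2 h, H h & act h x0 = v.
Hypothesis theta_inj : injective theta.
Hypothesis swapH : forall u v, exists h,
  [/\ H h, act h u = theta v & act h v = theta u].
Implicit Types (h k : gT) (u v w : X) (f g : fn) (V W : set fn).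

Lemma actK h : cancel (act h) (act h^-1%g).
Proof. by move=> x; rewrite -actM mulVg act1. Qed.

Lemma actVK h : cancel (act h^-1%g) (act h).
Proof. by move=> x; rewrite -actM mulgV act1. Qed.

(** The coset of Q that corresponds to the point v of X. *)
Definition fiber v : set gT := [set h | H h /\ act h x0 = v].

Lemma fiber_inj : injective fiber.
Proof.
move=> u v e; have [h Hh hu] := trH u.
have : fiber v h by rewrite -e.
by case=> _ <-.
Qed.

Lemma lmul_fiber h v : H h -> lmul h (fiber v) = fiber (act h v).
Proof.
move=> Hh; apply/seteqP; split => [_ [g [Hg <-] <-]|g [Hg gv]].
  by split; [apply: subgroupM|rewrite actM].
exists (h^-1 * g)%g; last by rewrite mulVKg.
split; first by apply: subgroupM => //; apply: subgroupV.
by rewrite actM gv actK.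
Qed.

Lemma lcosets_fiber : lcosets H Q = [set fiber v | v in setT].
Proof.
have QF : Q = fiber x0 by rewrite QE.
apply/seteqP; split => [_ [h Hh <-]|_ [v _ <-]].
  by exists (act h x0) => //; rewrite QF lmul_fiber.
by have [h Hh <-] := trH v; exists h => //; rewrite QF lmul_fiber.
Qed.

Lemma esum_lcosets (u : set gT -> R) : (forall A, 0 <= u A) ->
  (\esum_(A in lcosets H Q) (u A)%:E = (\sum_v u (fiber v))%:E)%E.
Proof.
move=> u0; rewrite lcosets_fiber esum_image; last by move=> ? ? _ _ /fiber_inj.
rewrite esum_fset; [|exact: finite_finset|by move=> *; rewrite lee_fin].
have -> : [set: X] = [set` index_enum X].
  by apply/seteqP; split=> // v _; rewrite /= mem_index_enum.
by rewrite -fsbig_seq ?index_enum_uniq // sumEFin.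
Qed.

Lemma abs_sum_lcosets (u : set gT -> R) :
  abs_sum (lcosets H Q) u = \sum_v u (fiber v).
Proof.
rewrite /abs_sum.
have -> : (\esum_(A in lcosets H Q) (EFin \o u)^\+ A =
    (\sum_v Num.max (u (fiber v)) 0)%:E)%E.
  rewrite -(@esum_lcosets (fun A => Num.max (u A) 0)); last first.
    by move=> A; rewrite le_max lexx orbT.
  by apply: eq_esum => A _; rewrite funeposE /= EFin_max.
have -> : (\esum_(A in lcosets H Q) (EFin \o u)^\- A =
    (\sum_v Num.max (- u (fiber v)) 0)%:E)%E.
  rewrite -(@esum_lcosets (fun A => Num.max (- u A) 0)); last first.
    by move=> A; rewrite le_max lexx orbT.
  by apply: eq_esum => A _; rewrite funenegE /= EFin_max.
rewrite -EFinB /= -sumrB; apply: eq_bigr => v _.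
case: (lerP 0 (u (fiber v))) => hu.
  by rewrite (max_idPr _) ?subr0 // oppr_le0.
by rewrite (max_idPl _) ?sub0r ?opprK // oppr_ge0 ltW.
Qed.

Lemma dotprod_fiber f g :
  dotprod H Q f g = \sum_v f (fiber v) * (g (fiber v))^*.
Proof.
rewrite /dotprod !abs_sum_lcosets; apply/eqP; rewrite eq_complex /=.
rewrite (raddf_sum (@complex.Re R : Rcomplex R -> R)).
by rewrite (raddf_sum (@complex.Im R : Rcomplex R -> R)) !eqxx.
Qed.

Lemma sqnorm_eq0 f : ell2 H Q f ->
  (sqnorm H Q f = 0)%E <-> f = (fun=> 0).
Proof.
move=> [f0 _]; rewrite /sqnorm.
pose u A := complex.Re (f A) ^+ 2 + complex.Im (f A) ^+ 2.
rewrite (@esum_lcosets u); last first.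
  by move=> A; rewrite addr_ge0 // sqr_ge0.
rewrite {}/u.
split=> [[/eqP]|->]; last by rewrite big1 //= => v _; rewrite expr0n addr0.
rewrite psumr_eq0; last by move=> v _; rewrite addr_ge0 // sqr_ge0.
move=> /allP e; apply/funext => A.
have [|/f0//] := pselect (lcosets H Q A).
rewrite lcosets_fiber => -[v _ <-].
have := e v; rewrite mem_index_enum => /(_ isT) /=.
rewrite paddr_eq0 ?sqr_ge0 // !sqrf_eq0.
by case: (f (fiber v)) => a b /= /andP[/eqP-> /eqP->].
Qed.

Definition invariant_kernel (K : X -> X -> C) : Prop :=
  forall h u v, H h -> K (act h u) (act h v) = K u v.

Definition kernel_mul (K L : X -> X -> C) u w : C := \sum_v K u v * L v w.

Lemma kernel_mul_invariant K L : invariant_kernel K -> invariant_kernel L ->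
  invariant_kernel (kernel_mul K L).
Proof.
move=> iK iL h u w Hh; rewrite /kernel_mul (reindex_inj (can_inj (actK h))).
by apply: eq_bigr => v _; rewrite iK // iL.
Qed.

(** Some element of H maps (v, u) to (theta u, theta v), so substituting theta in
   an invariant kernel transposes it. Substitution respects products of kernels
   whereas transposition reverses them; hence they commute. *)
Lemma kernel_mulC K L : invariant_kernel K -> invariant_kernel L ->
  kernel_mul K L = kernel_mul L K.
Proof.
move=> iK iL; apply/funext => u; apply/funext => w.
have swap M a b : invariant_kernel M -> M (theta b) (theta a) = M a b.
  by move=> iM; have [h [Hh <- <-]] := swapH a b; rewrite iM.
rewrite -(swap (kernel_mul L K)); last exact: kernel_mul_invariant.
rewrite /kernel_mul [RHS](reindex_inj theta_inj); apply: eq_bigr => v _ /=.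
by rewrite (swap L) // (swap K) // mulrC.
Qed.

(** H may be infinite; sums over it are replaced by sums over its finite image
   in the self-maps of X. *)
Definition motions : pred {ffun X -> X} :=
  fun s => `[< exists2 h, H h & s = finfun (act h) >].

Definition rep (s : {ffun X -> X}) : gT :=
  if pselect (exists2 h, H h & s = finfun (act h)) is left e
  then projT1 (cid2 e) else 1%g.

Lemma repP s : motions s -> H (rep s) /\ act (rep s) =1 s.
Proof.
rewrite /rep => /asboolP e; case: pselect => // e'.
by case: cid2 => h Hh /= ->; split=> // x; rewrite ffunE.
Qed.

(** The column at w of the operator obtained by averaging over H the rank-one
   operator k |-> <k, g> f. If f and g lie in subrepresentations V and W, this
   operator maps into V and vanishes on the orthogonal of W. *)
Definition average (f g : fn) (w : X) : fn :=
  lincomb (index_enum {ffun X -> X}) motions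
    (fun s => (g (fiber (s w)))^*) (fun s => quasi_regular (rep s)^-1%g f).

Lemma average_fiber f g w v :
  average f g w (fiber v) =
  \sum_(s | motions s) (g (fiber (s w)))^* * f (fiber (s v)).
Proof.
apply: eq_bigr => s /repP[Hs es].
by rewrite /quasi_regular invgK lmul_fiber // es.
Qed.

Lemma average_invariant f g :
  invariant_kernel (fun u w => average f g w (fiber u)).
Proof.
move=> h u w Hh; rewrite !average_fiber.
pose r k (s : {ffun X -> X}) : {ffun X -> X} := [ffun x => s (act k x)].
have rK k : cancel (r k) (r k^-1%g).
  by move=> s; apply/ffunP => x; rewrite !ffunE actVK.
rewrite [RHS](reindex_inj (can_inj (rK h))).
have rF k s : H k -> motions s -> motions (r k s).
  move=> Hk /asboolP[g' Hg ->]; apply/asboolP.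
  exists (g' * k)%g; first exact: subgroupM.
  by apply/ffunP => x; rewrite !ffunE actM.
apply: eq_big => s; last by rewrite !ffunE.
apply/idP/idP => [|Fs]; first exact: rF.
by rewrite -(rK h s); apply: rF => //; apply: subgroupV.
Qed.

Lemma average_subrep W f g w : subrep H Q W -> W f -> W (average f g w).
Proof.
move=> [_ lW _ iW] Wf; apply: lincomb_subspace => // s /repP[Hs _].
by apply: iW => //; apply: subgroupV.
Qed.

(** The averaged operator M is invariant, as is its adjoint N, so MN = NM. But MN
   maps into W1 and NM into W0, and these are orthogonal, so MN = 0. The diagonal
   entries of MN are the sums of |M(w,v)|^2 over v, so M = 0. *)
Lemma orthogonal_average_eq0 (W0 W1 : set fn) f0 f1 w u :
  subrep H Q W0 -> subrep H Q W1 -> orthogonal_subspaces H Q W0 W1 ->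
  W0 f0 -> W1 f1 -> average f1 f0 w (fiber u) = 0.
Proof.
move=> sW0 sW1 oW Wf0 Wf1.
pose M u w := average f1 f0 w (fiber u).
pose N u w := average f0 f1 w (fiber u).
have NE v t : N v t = (M t v)^*.
  rewrite /M /N !average_fiber rmorph_sum; apply: eq_bigr => s _ /=.
  by rewrite rmorphM /= conjcK mulrC.
have MN : kernel_mul M N = kernel_mul N M.
  by apply: kernel_mulC; apply: average_invariant.
(* p and q are the columns at u of NM, in W0, and of MN, in W1. *)
pose p : fn := lincomb (index_enum X) xpredT (fun v => M v u) (average f0 f1).
pose q : fn := lincomb (index_enum X) xpredT (fun v => N v u) (average f1 f0).
have Wp : W0 p.
  case: (sW0) => _ lW _ _.
  by apply: lincomb_subspace => // v _; apply: average_subrep.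
have Wq : W1 q.
  case: (sW1) => _ lW _ _.
  by apply: lincomb_subspace => // v _; apply: average_subrep.
have qE v : q (fiber v) = kernel_mul M N v u.
  by apply: eq_bigr => t _; rewrite mulrC.
have pE v : p (fiber v) = kernel_mul M N v u.
  by rewrite MN; apply: eq_bigr => t _; rewrite mulrC.
have := oW _ _ Wp Wq; rewrite dotprod_fiber => /eqP.
rewrite psumr_eq0; last by move=> v _; rewrite pE qE mulcJ_ge0.
move/allP/(_ u); rewrite mem_index_enum => /(_ isT) /=.
rewrite pE qE mulf_eq0 conjc_eq0 orbb.
rewrite /kernel_mul psumr_eq0; last by move=> v _; rewrite NE mulcJ_ge0.
move/allP/(_ w); rewrite mem_index_enum => /(_ isT) /=.
by rewrite NE mulf_eq0 conjc_eq0 orbb => /eqP.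
Qed.

(** Pulled back to V by U1 and pushed to W0 by U0, the vanishing averages of U1 f
   against U0 f become averages of U0 f against itself. The value of the latter at
   its own base point w is the sum of |U0 f (s w)|^2 over the motions s, among
   them s = id, so that U0 f vanishes. *)
Lemma equivalent_orthogonal_eq0 (V W0 W1 : set fn) : subrep H Q V ->
  subrep H Q W0 -> subrep H Q W1 -> orthogonal_subspaces H Q W0 W1 ->
  equivalent_subreps H Q V W0 -> equivalent_subreps H Q V W1 ->
  V = [set fun=> 0].
Proof.
move=> sV sW0 sW1 oW [U0 [VW0 U0D U0N U0H]] [U1 [VW1 U1D U1N U1H]].
have [Vl2 lV _ iV] := sV; have [W0l2 _ _ _] := sW0; have [W1l2 _ _ _] := sW1.
apply/seteqP; split=> [f Vf|_ ->]; last by case: lV.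
have Wf0 : W0 (U0 f) by rewrite -VW0; exists f.
have Wf1 : W1 (U1 f) by rewrite -VW1; exists f.
suff f0 : U0 f = (fun=> 0).
  apply/(sqnorm_eq0 (Vl2 _ Vf)); rewrite -U0N // f0.
  by apply/sqnorm_eq0 => //; rewrite -f0; apply: W0l2.
have transport U : (forall z f g, V f -> V g ->
           U (fun x => z * f x + g x) = (fun x => z * U f x + U g x)) ->
    (forall h f, H h -> V f ->
           U (quasi_regular h f) = quasi_regular h (U f)) ->
    forall w, U (average f (U0 f) w) = average (U f) (U0 f) w.
  move=> UD UH w; rewrite /average (lincomb_linear (W := V)) //; last first.
    by move=> s /repP[Hs _]; apply: iV => //; apply: subgroupV.
  apply/funext => A; apply: eq_bigr => s /repP[Hs _] /=.
  by rewrite UH //; apply: subgroupV.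
have a0 w : average (U0 f) (U0 f) w = (fun=> 0).
  have Vw : V (average f (U0 f) w) by apply: average_subrep.
  rewrite -transport //; apply/sqnorm_eq0.
    by apply: W0l2; rewrite -VW0; exists (average f (U0 f) w).
  rewrite U0N // -U1N // transport //; apply/sqnorm_eq0.
    by apply: W1l2; apply: average_subrep.
  apply/funext => A; have [|nA] := pselect (lcosets H Q A).
    rewrite lcosets_fiber => -[u _ <-].
    exact: (orthogonal_average_eq0 w u sW0 sW1).
  by have [-> //] := W1l2 _ (average_subrep (U0 f) w sW1 Wf1).
apply/funext => A; have [|nA] := pselect (lcosets H Q A); last first.
  by have [-> //] := W0l2 _ Wf0.
rewrite lcosets_fiber => -[u _ <-].
have /(congr1 (fun f : fn => f (fiber u))) := a0 u; rewrite average_fiber => /eqP.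
rewrite psumr_eq0; last by move=> s _; rewrite mulrC mulcJ_ge0.
move/allP/(_ (finfun id)); rewrite mem_index_enum => /(_ isT) /=.
rewrite ffunE mulf_eq0 conjc_eq0 orbb => /implyP e; apply/eqP/e.
apply/asboolP; exists 1%g; first exact: subgroup1.
by apply/ffunP => x; rewrite !ffunE act1.
Qed.

(** Two orthogonal copies of an irreducible V would force V = 0. *)
Theorem gelfand_trick : gelfand_pair R H Q.
Proof.
split=> //.
- rewrite QE; apply: subgroupP => [|k [Hk kx]|h k [Hh hx] [Hk kx]].
  + by split; [exact: subgroup1|rewrite act1].
  + by split; [exact: subgroupV|rewrite -{1}kx actK].
  + by split; [exact: subgroupM|rewrite actM kx].
- by rewrite QE => h [].
move=> V [sV V0 _]; split.
  exists (fun=> V); split=> // [_|i j]; last by rewrite !ord1.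
  by exists id; split=> //; rewrite image_id.
move=> [W [sW eW oW]]; apply: V0.
exact: (equivalent_orthogonal_eq0 sV (sW ord0) (sW ord_max) (oW ord0 ord_max isT)
  (eW _) (eW _)).
Qed.

End GelfandTrick.

(** * Tree automorphisms and their sections *)

Section TreeAut.
Variable d : nat.
Implicit Types (g h k : tree_aut d) (u v w : word d).

Lemma aut_mulE g h w : (g * h)%g w = g (h w). Proof. by []. Qed.
Lemma aut_1E w : (1%g : tree_aut d) w = w. Proof. by []. Qed.
Lemma aut_VE g w : g^-1%g w = aut_inv g w. Proof. by []. Qed.

(** A proper prefix goes to a proper prefix, so each letter appended to w lengthens
   g w. *)
Lemma leq_size_aut g w : (size w <= size (g w))%N.
Proof.
elim/last_ind: w => // w y IH; rewrite size_rcons (leq_ltn_trans IH) //.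
have : prefix (g w) (g (rcons w y)) by rewrite aut_prefix prefix_rcons.
case/prefixP => [[|z s]] e; last by rewrite e size_cat /= addnS leq_addr.
move: e; rewrite cats0 => /(can_inj (aut_funK g))/(congr1 size).
by rewrite size_rcons => /eqP; rewrite -[X in _ == X]addn0 -addn1 eqn_add2l.
Qed.

Lemma size_aut g w : size (g w) = size w.
Proof.
apply/eqP; rewrite eqn_leq leq_size_aut andbT.
by rewrite -{2}(aut_funK g w) (leq_size_aut (aut_V g)).
Qed.

Definition aut_tuple n g (v : n.-tuple 'I_d) : n.-tuple 'I_d :=
  @Tuple n _ (g v) (introT eqP (etrans (size_aut g v) (size_tuple v))).

(** The sections at y, in the sense of self-similar groups, of the stabiliser of y
   in K. Iterated, as in sections (sections K y) z, it descends to deeper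
   vertices. *)
Definition sections (K : set (tree_aut d)) (y : 'I_d) : set (tree_aut d) :=
  [set g | exists2 k, K k & forall w, k (y :: w) = y :: g w].

Lemma sections_subgroup K y : is_subgroup K -> is_subgroup (sections K y).
Proof.
move=> sK; apply: subgroupP => [|g [k Kk kE]|g h [k Kk kE] [l Kl lE]].
- by exists 1%g; [exact: subgroup1|].
- exists k^-1%g; first exact: subgroupV.
  by move=> w; apply: (can_inj (aut_funK k)); rewrite kE aut_invK aut_invK.
- exists (k * l)%g; first exact: subgroupM.
  by move=> w; rewrite !aut_mulE lE kE.
Qed.

Definition ray_stabilizer (K : set (tree_aut d)) (x : 'I_d) : set (tree_aut d) :=
  [set g | K g /\ forall m, g (nseq m x) = nseq m x].

Lemma ray_stabilizer_subgroup K x :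
  is_subgroup K -> is_subgroup (ray_stabilizer K x).
Proof.
move=> sK; apply: subgroupP => [|g [Kg gx]|g h [Kg gx] [Kh hx]].
- by split; [exact: subgroup1|].
- by split; [exact: subgroupV|move=> m; rewrite aut_VE -{1}(gx m) aut_funK].
- by split; [exact: subgroupM|move=> m; rewrite aut_mulE hx gx].
Qed.

Lemma ray_stabilizerP K x g k : K k -> (forall w, k (x :: w) = x :: g w) ->
  (forall m, g (nseq m x) = nseq m x) -> ray_stabilizer K x k.
Proof.
move=> Kk kE gx; split=> // -[|m]; last by rewrite kE gx.
by apply/nilP; rewrite /nilp size_aut.
Qed.

End TreeAut.

(** * Pairs of vertices under a self-similar group *)

Section TwoPoint.
Variable p : nat.
Local Notation aut := (tree_aut p.+1).
Local Notation letter := 'I_p.+1.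
Implicit Types (g h k : aut) (u v w s t : word p.+1) (x y z : letter).

(** The permutation of the children of w induced by f is a power of the cyclic
   shift. *)
Definition rotates_at (f : word p.+1 -> word p.+1) w : Prop :=
  exists c, forall y, f (rcons w y) = rcons (f w) (y + c).

Definition rotates g : Prop := forall w, rotates_at g w.

Lemma rotates_at_nil f : f [::] = [::] -> (forall y, f [:: y] = [:: y]) ->
  rotates_at f [::].
Proof. by move=> f0 f1; exists 0 => y; rewrite /= f0 f1 addr0. Qed.

Lemma rotates_at_cons f f' y w : (forall u, f (y :: u) = y :: f' u) ->
  rotates_at f' w -> rotates_at f (y :: w).
Proof. by move=> fE [c cE]; exists c => z; rewrite rcons_cons !fE cE. Qed.

Lemma rotates_id w : rotates_at id w.
Proof. by exists 0 => y; rewrite addr0. Qed.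

Lemma rotates_subgroup : is_subgroup [set g | rotates g].
Proof.
apply: subgroupP => [w|g rg w|g h rg rh w].
- by exists 0 => y; rewrite addr0.
- have [c cE] := rg (g^-1%g w); exists (- c) => y.
  apply: (can_inj (aut_funK g)); rewrite cE subrK aut_VE.
  by rewrite !aut_invK.
- have [c cE] := rh w; have [e eE] := rg (h w); exists (c + e) => y.
  by rewrite !aut_mulE cE eE addrA.
Qed.

(** The relative position z - y of the letters at which two words diverge is
   preserved: the same c serves all children of w. *)
Lemma rotates_split g w : rotates g -> exists c, forall y s,
  exists2 t, size t = size s & g (w ++ y :: s) = g w ++ (y + c) :: t.
Proof.
move=> /(_ w)[c cE]; exists c => y s.
have : prefix (g (rcons w y)) (g (w ++ y :: s)).
  by rewrite aut_prefix -cat_rcons prefix_prefix.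
case/prefixP => t e; exists t; last by rewrite e cE cat_rcons.
move/(congr1 size): e; rewrite size_aut !size_cat size_aut size_rcons /= addnS addSn.
by move=> [] /addnI.
Qed.

Lemma ordS_add y : ordS y = y + inZp 1.
Proof. by apply: val_inj; rewrite [RHS]modnDmr addn1. Qed.

Lemma aut_a_cons y w : aut_a p.+1 (y :: w) = (y + inZp 1) :: w.
Proof. by rewrite /= ordS_add. Qed.

Lemma rotates_a : rotates (aut_a p.+1).
Proof.
case=> [|y w]; first by exists (inZp 1) => y; rewrite aut_a_cons.
by exists 0 => z; rewrite rcons_cons !aut_a_cons addr0.
Qed.

Lemma first_letter_transitive (K : set aut) : is_subgroup K -> K (aut_a p.+1) ->
  forall y z, exists2 k, K k & forall w, k (y :: w) = z :: w.
Proof.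
move=> sK Ka y z.
suff [k Kk kE] : exists2 k, K k &
    forall w, k (y :: w) = (y + inZp (val (z - y))) :: w.
  by exists k => // w; rewrite kE valZpK addrC subrK.
elim: (val (z - y)) => [|i [k Kk kE]].
  exists 1%g; first exact: subgroup1.
  move=> w; rewrite aut_1E; congr cons.
  by apply: val_inj; rewrite /= mod0n addn0 modn_small.
exists (aut_a p.+1 * k)%g; first exact: subgroupM.
move=> w; rewrite aut_mulE kE aut_a_cons; congr cons.
by rewrite -addrA; congr (_ + _); apply: val_inj; rewrite [LHS]modnDm addn1.
Qed.

Definition level_transitive (K : set aut) n : Prop :=
  forall u v, size u = n -> size v = n -> exists2 k, K k & k u = v.

Lemma level_transitive0 (K : set aut) : is_subgroup K -> level_transitive K 0.
Proof.
move=> sK u v /size0nil-> /size0nil->.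
by exists 1%g; first exact: subgroup1.
Qed.

(** Move the first letter to z by powers of a, act below z, and move z to the
   wanted letter. *)
Lemma level_transitiveS (K H : set aut) z n : is_subgroup K -> K (aut_a p.+1) ->
  H `<=` sections K z -> level_transitive H n -> level_transitive K n.+1.
Proof.
move=> sK Ka HK trH [//|y u] [//|y' v] [su] [sv].
have [h Hh hu] := trH _ _ su sv; have [k Kk kE] := HK _ Hh.
have [i Ki iE] := first_letter_transitive sK Ka y z.
have [j Kj jE] := first_letter_transitive sK Ka z y'.
exists (j * (k * i))%g; first by do 2!apply: subgroupM => //.
by rewrite !aut_mulE iE kE hu jE.
Qed.

Lemma common_prefix u v : size u = size v -> u != v ->
  exists w y z s t, [/\ y != z, size s = size t, u = w ++ y :: s & v = w ++ z :: t].
Proof.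
elim: u v => [|y u IH] [|z v] //= [suv]; rewrite eqseq_cons.
have [->|yz] := eqVneq y z; last by move=> _; exists [::], y, z, u, v.
move=> /= /(IH _ suv)[w [y' [z' [s [t [? ? -> ->]]]]]].
by exists (z :: w), y', z', s, t.
Qed.

Lemma cat_nseq x n w y s : w ++ y :: s = nseq n x -> w = nseq (size w) x /\ y = x.
Proof.
move=> e; have : all (pred1 x) (w ++ y :: s) by rewrite e all_pred1_nseq.
by rewrite all_cat /= => /and3P[/all_pred1P ? /eqP ? _].
Qed.

Variables (H : set aut) (x : letter).
Local Notation P := (ray_stabilizer H x).
Hypothesis sH : is_subgroup H.
Hypothesis rotH : H `<=` [set g | rotates g].
Hypothesis aH : H (aut_a p.+1).
Hypothesis recurrentH : H `<=` sections H x.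
Hypothesis branchH : forall y, y != x ->
  sections P y (aut_a p.+1) /\ exists z, H `<=` sections (sections P y) z.

Lemma self_similar_transitive n : level_transitive H n.
Proof.
elim: n => [|n IH]; first exact: level_transitive0.
exact: (level_transitiveS sH aH recurrentH IH).
Qed.

Lemma sections_transitive y n : y != x -> level_transitive (sections P y) n.
Proof.
have sS := sections_subgroup y (ray_stabilizer_subgroup x sH).
case: n => [_|n /branchH[Sa [z HS]]]; first exact: level_transitive0.
exact: (level_transitiveS sS Sa HS (@self_similar_transitive n)).
Qed.

Lemma lift_along_ray g i : P g ->
  exists2 k, P k & forall w, k (nseq i x ++ w) = nseq i x ++ g w.
Proof.
move=> Pg; elim: i => [|i [k [Hk kx] kE]]; first by exists g.
have [l Hl lE] := recurrentH Hk.
exists l; first exact: (ray_stabilizerP Hl lE).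
by move=> w /=; rewrite lE kE.
Qed.

(** The orbits of the ray stabiliser on a level: the words leaving the ray at a
   given place with a given letter. *)
Lemma sphere_transitive i y u v : y != x -> size u = size v ->
  exists2 h, P h & h (nseq i x ++ y :: u) = nseq i x ++ y :: v.
Proof.
move=> yx suv; have [g [k Pk kE] gu] := sections_transitive yx suv erefl.
by have [l Pl lE] := lift_along_ray i Pk; exists l; rewrite // lE kE gu.
Qed.

(** Negating letters turns the relative position z - y of u and v at their point
   of divergence into y - z, which is the relative position of v and u. Hence
   after u and -v are both moved onto the ray, v and -u leave the ray at the same
   place with the same letter, and sphere_transitive connects them. *)
Lemma swap_words u v : size u = size v ->
  exists h, [/\ H h, h u = map -%R v & h v = map -%R u].
Proof.
move=> suv; have [<-|uv] := eqVneq u v.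
  have [h Hh hu] := @self_similar_transitive (size u) u (map -%R u)
    erefl (size_map _ _).
  by exists h.
have [w [y [z [s [t [yz sst uE vE]]]]]] := common_prefix suv uv.
set n := size u; set i := size w.
have [h1 Hh1 h1u] := @self_similar_transitive n u (nseq n x) erefl (size_nseq _ _).
have [h2 Hh2 h2v] := @self_similar_transitive n (map -%R v) (nseq n x)
  (etrans (size_map _ _) (esym suv)) (size_nseq _ _).
have [c cE] := rotates_split w (rotH Hh1).
have [e eE] := rotates_split (map -%R w) (rotH Hh2).
have [s1 ss1 s1E] := cE y s; have [t1 st1 t1E] := cE z t.
have [s2 ss2 s2E] := eE (- y) (map -%R s).
have [t2 st2 t2E] := eE (- z) (map -%R t).
have [w1 yc] := cat_nseq (etrans (esym s1E) (etrans (congr1 h1 (esym uE)) h1u)).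
have vE' : map -%R v = map -%R w ++ - z :: map -%R t by rewrite vE map_cat.
have uE' : map -%R u = map -%R w ++ - y :: map -%R s by rewrite uE map_cat.
have [w2 ze] := cat_nseq (etrans (esym t2E) (etrans (congr1 h2 (esym vE')) h2v)).
rewrite size_aut in w1; rewrite size_aut size_map in w2.
have zc : z + c = - y + e.
  have -> : c = x - y by rewrite -yc addrC addKr.
  by have -> : e = z + x; [rewrite -ze addNKr|rewrite addrA addrC].
have zx : z + c != x by rewrite -yc (inj_eq (addIr c)) eq_sym.
have [h3 [Hh3 h3x] h3E] := @sphere_transitive i (z + c) t1 s2 zx
  (etrans st1 (etrans (esym sst) (esym (etrans ss2 (size_map _ _))))).
exists (h2^-1 * (h3 * h1))%g; split.
- by apply: subgroupM; [|exact: subgroupV|exact: subgroupM].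
- by rewrite !aut_mulE h1u h3x -h2v aut_VE aut_funK.
- rewrite !aut_mulE {1}vE t1E w1 h3E aut_VE zc.
  by rewrite uE' -[RHS](aut_funK h2) s2E w2.
Qed.

(** Gelfand's trick for the action on a level, with theta the negation of
   letters; for two letters theta is the identity. *)
Theorem self_similar_gelfand (R : realType) n :
  gelfand_pair R H (level_stabilizer H x n).
Proof.
pose act g (v : n.-tuple letter) := aut_tuple g v.
apply: (@gelfand_trick R aut _ act H _ [tuple of nseq n x] (map_tuple -%R)) => //.
- by move=> v; apply: val_inj.
- by move=> g h v; apply: val_inj.
- apply/seteqP; split=> g [Hg gx]; split=> //; first exact: val_inj.
  exact: (congr1 val gx).
- move=> v; have [h Hh hv] := self_similar_transitive (size_nseq n x) (size_tuple v).
  by exists h => //; apply: val_inj.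
- by move=> u v /(congr1 val) /(inj_map oppr_inj) /val_inj.
- move=> u v; have [|h [Hh hu hv]] := @swap_words u v; first by rewrite !size_tuple.
  by exists h; split=> //; apply: val_inj.
Qed.

End TwoPoint.

(** * The groups on the binary tree *)

Section Binary.
Local Notation o0 := (@ord0 1).
Local Notation o1 := (@ord_max 1).
Implicit Type w : word 2.

Lemma letter2P (y : 'I_2) : y != o1 -> y = o0.
Proof. by case: y => [[|[|]]] // ? _; apply: val_inj. Qed.

Lemma a2_0 w : aut_a 2 (o0 :: w) = o1 :: w.
Proof. by congr cons; apply: val_inj. Qed.
Lemma a2_1 w : aut_a 2 (o1 :: w) = o0 :: w.
Proof. by congr cons; apply: val_inj. Qed.

Lemma b_0 w : aut_b (o0 :: w) = o0 :: aut_a 2 w. Proof. by []. Qed.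
Lemma b_1 w : aut_b (o1 :: w) = o1 :: aut_c w. Proof. by []. Qed.
Lemma c_0 w : aut_c (o0 :: w) = o0 :: aut_a 2 w. Proof. by []. Qed.
Lemma c_1 w : aut_c (o1 :: w) = o1 :: aut_d w. Proof. by []. Qed.
Lemma d_0 w : aut_d (o0 :: w) = o0 :: w. Proof. by []. Qed.
Lemma d_1 w : aut_d (o1 :: w) = o1 :: aut_b w. Proof. by []. Qed.

Lemma bt_0 w : aut_bt (o0 :: w) = o0 :: aut_a 2 w. Proof. by []. Qed.
Lemma bt_1 w : aut_bt (o1 :: w) = o1 :: aut_ct w. Proof. by []. Qed.
Lemma ct_0 w : aut_ct (o0 :: w) = o0 :: w. Proof. by []. Qed.
Lemma ct_1 w : aut_ct (o1 :: w) = o1 :: aut_dt w. Proof. by []. Qed.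
Lemma dt_0 w : aut_dt (o0 :: w) = o0 :: w. Proof. by []. Qed.
Lemma dt_1 w : aut_dt (o1 :: w) = o1 :: aut_bt w. Proof. by []. Qed.

Let a2E := (@aut_mulE 2, a2_0, a2_1).
Let bcdE := (a2E, b_0, b_1, c_0, c_1, d_0, d_1).
Let bcdtE := (a2E, bt_0, bt_1, ct_0, ct_1, dt_0, dt_1).

Lemma rotates_bcd : [/\ rotates aut_b, rotates aut_c & rotates aut_d].
Proof.
suff h w : [/\ rotates_at b_fun w, rotates_at c_fun w & rotates_at d_fun w].
  by split=> w; case: (h w).
elim: w => [|x w [hb hc hd]].
  by split; apply: rotates_at_nil => // y /=; case: ifP.
case e: (x == ord0).
  split; [apply: (@rotates_at_cons _ _ (@a_fun 2))
    | apply: (@rotates_at_cons _ _ (@a_fun 2))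
    | apply: (@rotates_at_cons _ _ id)]; try by move=> u /=; rewrite e.
  - exact: rotates_a.
  - exact: rotates_a.
  - exact: rotates_id.
split; [apply: rotates_at_cons hc | apply: rotates_at_cons hd
  | apply: rotates_at_cons hb];
  by move=> u /=; rewrite e.
Qed.

Lemma rotates_bcdt : [/\ rotates aut_bt, rotates aut_ct & rotates aut_dt].
Proof.
suff h w : [/\ rotates_at bt_fun w, rotates_at ct_fun w & rotates_at dt_fun w].
  by split=> w; case: (h w).
elim: w => [|x w [hb hc hd]].
  by split; apply: rotates_at_nil => // y /=; case: ifP.
case e: (x == ord0).
  split; [apply: (@rotates_at_cons _ _ (@a_fun 2)) | apply: (@rotates_at_cons _ _ id)
    | apply: (@rotates_at_cons _ _ id)]; try by move=> u /=; rewrite e.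
  - exact: rotates_a.
  - exact: rotates_id.
  - exact: rotates_id.
split; [apply: rotates_at_cons hc | apply: rotates_at_cons hd
  | apply: rotates_at_cons hb];
  by move=> u /=; rewrite e.
Qed.

Lemma bcd_ray m : [/\ aut_b (nseq m o1) = nseq m o1, aut_c (nseq m o1) = nseq m o1
  & aut_d (nseq m o1) = nseq m o1].
Proof.
elim: m => [//|m [hb hc hd]]; rewrite -[nseq m.+1 _]/(o1 :: nseq m o1).
by split; rewrite bcdE ?hb ?hc ?hd.
Qed.

Lemma bcdt_ray m : [/\ aut_bt (nseq m o1) = nseq m o1, aut_ct (nseq m o1) = nseq m o1
  & aut_dt (nseq m o1) = nseq m o1].
Proof.
elim: m => [//|m [hb hc hd]]; rewrite -[nseq m.+1 _]/(o1 :: nseq m o1).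
by split; rewrite bcdtE ?hb ?hc ?hd.
Qed.

(** With this, the generators a, b and c suffice for G. *)
Lemma klein_four : [/\ (aut_b * aut_c)%g = aut_d, (aut_c * aut_d)%g = aut_b
  & (aut_d * aut_b)%g = aut_c].
Proof.
suff h w : [/\ b_fun (c_fun w) = d_fun w, c_fun (d_fun w) = b_fun w
    & d_fun (b_fun w) = c_fun w].
  by split; apply: tree_aut_eq => w; case: (h w).
elim: w => [//|x w [hb hc hd]] /=.
by case: (x == ord0); rewrite ?a_fun2K ?hb ?hc ?hd.
Qed.

(** In the notation g = (g0, g1) for sections, b = (a,c), c = (a,d), d = (1,b).
   The ray stabiliser acts below 0 at least by a, b and dad, from the elements
   b = (a,c), ada = (b,1) and aca c aca = (dad, ada). The elements b, aba, dad a
   of the group that these generate have sections a, c, b at 0. *)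
Theorem gelfand_G (R : realType) n :
  gelfand_pair R G_group (level_stabilizer G_group o1 n).
Proof.
set H := G_group.
have sH : is_subgroup H by apply: generated_subgroup.
have [Ha Hb Hc Hd] : [/\ H (aut_a 2), H aut_b, H aut_c & H aut_d].
  by split; apply: sub_generated => /=; tauto.
have HS K y : is_subgroup K -> sections K y (aut_a 2) -> sections K y aut_b ->
    sections K y aut_c -> H `<=` sections K y.
  move=> sK Sa Sb Sc; apply: generated_sub; first exact: sections_subgroup.
  move=> _ [[[->|->]|->]|->] //.
  by have [<- _ _] := klein_four; apply: (subgroupM (sections_subgroup y sK)).
apply: self_similar_gelfand => //.
- apply: generated_sub; first exact: rotates_subgroup.
  have [rb rc rd] := rotates_bcd.
  by move=> _ [[[->|->]|->]|->] //; apply: rotates_a.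
- apply: HS => //.
  + exists (aut_a 2 * (aut_b * aut_a 2))%g; first by do ?apply: (subgroupM sH).
    by move=> w; rewrite !bcdE.
  + by exists aut_d => // w; rewrite !bcdE.
  + by exists aut_b => // w; rewrite !bcdE.
move=> y /letter2P ->.
set P := ray_stabilizer H o1; set S := sections P o0.
have sP : is_subgroup P by apply: ray_stabilizer_subgroup.
have sS : is_subgroup S by apply: sections_subgroup.
have Sa : S (aut_a 2).
  exists aut_b => [|w]; last by rewrite !bcdE.
  by split=> // m; have [] := bcd_ray m.
have Sb : S aut_b.
  exists (aut_a 2 * (aut_d * aut_a 2))%g => [|w]; last by rewrite !bcdE.
  apply: (@ray_stabilizerP _ _ _ 1%g) => // [|w]; last by rewrite !bcdE.
  by do ?apply: (subgroupM sH).
have Sdad : S (aut_d * (aut_a 2 * aut_d))%g.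
  exists (aut_a 2 * (aut_c * (aut_a 2 * (aut_c * (aut_a 2 *
    (aut_c * aut_a 2))))))%g
    => [|w]; last by rewrite !bcdE.
  apply: (@ray_stabilizerP _ _ _ (aut_a 2 * (aut_d * aut_a 2))%g) => [|w|m].
  + by do ?apply: (subgroupM sH).
  + by rewrite !bcdE.
  + by case: m => [|m]; rewrite ?[nseq m.+1 _]/(o1 :: nseq m o1) !bcdE.
split=> //; exists o0; apply: HS => //.
- by exists aut_b => // w; rewrite !bcdE.
- exists (aut_d * (aut_a 2 * aut_d) * aut_a 2)%g => [|w]; last by rewrite !bcdE.
  exact: (subgroupM sS).
- exists (aut_a 2 * (aut_b * aut_a 2))%g => [|w]; last by rewrite !bcdE.
  by do ?apply: (subgroupM sS).
Qed.

(** Here b = (a,c), c = (1,d), d = (1,b). Below 0 the ray stabiliser acts at least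
   by a, b, d and cac, from b, ada, aca = (d,1) and aba b aba = (cac, aca). The
   group generated by these has the sections a, c, b, d at 0, by b, aba, ada and
   cac a = (d,d). Without cac this would fail: the elements of <a,b,d> that fix the
   vertex 0 have sections in <a,b,c> there, those of <a,b,c> have sections in
   <a,c,d>, and <a,c,d> is not transitive on the second level. *)
Theorem gelfand_Gtilde (R : realType) n :
  gelfand_pair R Gtilde_group (level_stabilizer Gtilde_group o1 n).
Proof.
set H := Gtilde_group.
have sH : is_subgroup H by apply: generated_subgroup.
have [Ha Hb Hc Hd] : [/\ H (aut_a 2), H aut_bt, H aut_ct & H aut_dt].
  by split; apply: sub_generated => /=; tauto.
have HS K y : is_subgroup K -> sections K y (aut_a 2) -> sections K y aut_bt ->
    sections K y aut_ct -> sections K y aut_dt -> H `<=` sections K y.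
  move=> sK Sa Sb Sc Sd; apply: generated_sub; first exact: sections_subgroup.
  by move=> _ [[[->|->]|->]|->].
apply: self_similar_gelfand => //.
- apply: generated_sub; first exact: rotates_subgroup.
  have [rb rc rd] := rotates_bcdt.
  by move=> _ [[[->|->]|->]|->] //; apply: rotates_a.
- apply: HS => //.
  + exists (aut_a 2 * (aut_bt * aut_a 2))%g; first by do ?apply: (subgroupM sH).
    by move=> w; rewrite !bcdtE.
  + by exists aut_dt => // w; rewrite !bcdtE.
  + by exists aut_bt => // w; rewrite !bcdtE.
  + by exists aut_ct => // w; rewrite !bcdtE.
move=> y /letter2P ->.
set P := ray_stabilizer H o1; set S := sections P o0.
have sP : is_subgroup P by apply: ray_stabilizer_subgroup.
have sS : is_subgroup S by apply: sections_subgroup.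
have Sa : S (aut_a 2).
  exists aut_bt => [|w]; last by rewrite !bcdtE.
  by split=> // m; have [] := bcdt_ray m.
have Sb : S aut_bt.
  exists (aut_a 2 * (aut_dt * aut_a 2))%g => [|w]; last by rewrite !bcdtE.
  apply: (@ray_stabilizerP _ _ _ 1%g) => // [|w]; last by rewrite !bcdtE.
  by do ?apply: (subgroupM sH).
have Sd : S aut_dt.
  exists (aut_a 2 * (aut_ct * aut_a 2))%g => [|w]; last by rewrite !bcdtE.
  apply: (@ray_stabilizerP _ _ _ 1%g) => // [|w]; last by rewrite !bcdtE.
  by do ?apply: (subgroupM sH).
have Scac : S (aut_ct * (aut_a 2 * aut_ct))%g.
  exists (aut_a 2 * (aut_bt * (aut_a 2 * (aut_bt * (aut_a 2 *
    (aut_bt * aut_a 2))))))%g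
    => [|w]; last by rewrite !bcdtE.
  apply: (@ray_stabilizerP _ _ _ (aut_a 2 * (aut_ct * aut_a 2))%g) => [|w|m].
  + by do ?apply: (subgroupM sH).
  + by rewrite !bcdtE.
  + by case: m => [|m]; rewrite ?[nseq m.+1 _]/(o1 :: nseq m o1) !bcdtE.
split=> //; exists o0; apply: HS => //.
- by exists aut_bt => // w; rewrite !bcdtE.
- exists (aut_a 2 * (aut_dt * aut_a 2))%g => [|w]; last by rewrite !bcdtE.
  by do ?apply: (subgroupM sS).
- exists (aut_a 2 * (aut_bt * aut_a 2))%g => [|w]; last by rewrite !bcdtE.
  by do ?apply: (subgroupM sS).
- exists (aut_ct * (aut_a 2 * aut_ct) * aut_a 2)%g => [|w]; last by rewrite !bcdtE.
  exact: (subgroupM sS).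
Qed.

End Binary.

(** * The groups on the ternary tree *)

Section Ternary.
Local Notation o0 := (@ord0 2).
Local Notation o1 := (@inord 2 1).
Local Notation o2 := (@ord_max 2).
Implicit Types (w : word 3) (e : nat).

Lemma letter3P (y : 'I_3) : y != o2 -> y = o0 \/ y = o1.
Proof.
case: y => [[|[|[|]]]] // ? _; [left|right]; apply: val_inj => //=.
by rewrite inordK.
Qed.

Lemma a3_0 w : aut_a 3 (o0 :: w) = o1 :: w.
Proof. by congr cons; apply: val_inj; rewrite /= inordK. Qed.
Lemma a3_1 w : aut_a 3 (o1 :: w) = o2 :: w.
Proof. by congr cons; apply: val_inj; rewrite /= inordK. Qed.
Lemma a3_2 w : aut_a 3 (o2 :: w) = o0 :: w.
Proof. by congr cons; apply: val_inj. Qed.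

Lemma t_0 e w : aut_t e (o0 :: w) = o0 :: aut_a 3 w. Proof. by []. Qed.
Lemma t_1 e w : aut_t e (o1 :: w) = o1 :: iter e (aut_a 3) w.
Proof. by rewrite /= inordK. Qed.
Lemma t_2 e w : aut_t e (o2 :: w) = o2 :: aut_t e w. Proof. by []. Qed.

Lemma aV3_0 w : (aut_a 3)^-1%g (o0 :: w) = o2 :: w.
Proof. by rewrite -[in LHS]a3_2 aut_VE aut_funK. Qed.
Lemma aV3_1 w : (aut_a 3)^-1%g (o1 :: w) = o0 :: w.
Proof. by rewrite -[in LHS]a3_0 aut_VE aut_funK. Qed.
Lemma aV3_2 w : (aut_a 3)^-1%g (o2 :: w) = o1 :: w.
Proof. by rewrite -[in LHS]a3_1 aut_VE aut_funK. Qed.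

Lemma iter_aE e w : iter e (aut_a 3) w = (aut_a 3 ^+ e)%g w.
Proof. by elim: e => [|e IH] //=; rewrite IH expgS. Qed.

Lemma tV_0 e w : (aut_t e)^-1%g (o0 :: w) = o0 :: (aut_a 3)^-1%g w.
Proof. by []. Qed.
Lemma tV_1 e w : (aut_t e)^-1%g (o1 :: w) = o1 :: ((aut_a 3) ^+ e)^-1%g w.
Proof.
apply: (can_inj (aut_funK (aut_t e))).
by rewrite t_1 iter_aE !(aut_VE, aut_invK).
Qed.
Lemma tV_2 e w : (aut_t e)^-1%g (o2 :: w) = o2 :: (aut_t e)^-1%g w.
Proof. by []. Qed.

Let atE := (@aut_mulE 3, a3_0, a3_1, a3_2, aV3_0, aV3_1, aV3_2, t_0, t_1, t_2,
  tV_0, tV_1, tV_2).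

Lemma rotates_t e : rotates (aut_t e).
Proof.
suff h w : rotates_at (t_fun e) w by [].
elim: w => [|x w IH].
  apply: rotates_at_nil => // y /=.
  by case: (nat_of_ord y) => [|[|]] //; congr cons; elim: e => //= e ->.
case: x => [[|[|[|]]]] // xP.
- by apply: (@rotates_at_cons _ _ (@a_fun 3)) => //; apply: rotates_a.
- apply: (@rotates_at_cons _ _ (aut_a 3 ^+ e)%g).
    by move=> u; rewrite -iter_aE.
  suff : (rotates (aut_a 3 ^+ e)%g) by apply.
  elim: e {IH} => [|e IH]; first exact: (subgroup1 (@rotates_subgroup 2)).
  rewrite expgS; apply: (subgroupM (@rotates_subgroup 2)) => //.
  exact: rotates_a.
- exact: rotates_at_cons IH.
Qed.

Lemma t_ray e m : aut_t e (nseq m o2) = nseq m o2.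
Proof. by elim: m => [//|m IH]; rewrite -[nseq m.+1 _]/(o2 :: nseq m o2) t_2 IH. Qed.

Lemma a3_cubed w : aut_a 3 (aut_a 3 (aut_a 3 w)) = w.
Proof.
case: w => [//|x w]; have [->|/letter3P[->|->]] := eqVneq x o2;
  by rewrite !(a3_0, a3_1, a3_2).
Qed.

Lemma aVK w : aut_a 3 ((aut_a 3)^-1%g w) = w.
Proof. exact: (aut_invK (aut_a 3)). Qed.

(** The section of t at 2 is t, and that of its conjugate by a is a. *)
Lemma sections_recurrent (K : set (tree_aut 3)) e : is_subgroup K ->
  K (aut_a 3) -> K (aut_t e) -> generated [set aut_a 3; aut_t e] `<=` sections K o2.
Proof.
move=> sK Ka Kt; apply: generated_sub; first exact: sections_subgroup.
move=> _ [->|->]; last by exists (aut_t e) => // w; rewrite !atE.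
exists ((aut_a 3)^-1 * (aut_t e * aut_a 3))%g => [|w]; last by rewrite !atE.
by do ?apply: (subgroupM sK) => //; apply: (subgroupV sK).
Qed.

Lemma gelfand_Gamma_type (R : realType) e n :
  let H := generated [set aut_a 3; aut_t e] in
  let S := sections (ray_stabilizer H o2) in
  (forall y, y != o2 -> S y (aut_a 3) /\ exists z, H `<=` sections (S y) z) ->
  gelfand_pair R H (level_stabilizer H o2 n).
Proof.
move=> H S br.
have sH : is_subgroup H by apply: generated_subgroup.
have [Ha Ht] : H (aut_a 3) /\ H (aut_t e).
  by split; apply: sub_generated => /=; tauto.
apply: self_similar_gelfand => //; last exact: sections_recurrent.
apply: generated_sub; first exact: rotates_subgroup.
by move=> _ [->|->]; [apply: rotates_a|apply: rotates_t].
Qed.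

(** Here t = (a,1,t), and its conjugates are ata^-1 = (t,a,1) and
   a^-1ta = (1,t,a). The first two fix the ray, and below 0 they give t and a.
   Below 1 the stabiliser acts at least by a and by the conjugates of a under t
   and t^-1, which conjugating ata^-1 by a^-1ta and by its inverse provides. The
   group generated by these has the sections t and a at 2, because [t,a] = tat^-1a^-1 and
   a (t^-1at) a^-2 do. *)
Theorem gelfand_Gamma (R : realType) n :
  gelfand_pair R Gamma_group (level_stabilizer Gamma_group o2 n).
Proof.
apply: gelfand_Gamma_type => y.
rewrite -[generated _]/Gamma_group; set H := Gamma_group.
have sH : is_subgroup H by apply: generated_subgroup.
have [Ha Ht] : H (aut_a 3) /\ H (aut_t 0).
  by split; apply: sub_generated => /=; tauto.
have Hata : H (aut_a 3 * aut_t 0 * (aut_a 3)^-1)%g.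
  by do ?apply: (subgroupM sH) => //; apply: (subgroupV sH).
have Haat : H ((aut_a 3)^-1 * aut_t 0 * aut_a 3)%g.
  by do ?apply: (subgroupM sH) => //; apply: (subgroupV sH).
have Haatv : H ((aut_a 3)^-1 * (aut_t 0)^-1 * aut_a 3)%g.
  by do ?apply: (subgroupM sH) => //; apply: (subgroupV sH).
set P := ray_stabilizer H o2.
have sP : is_subgroup P by apply: ray_stabilizer_subgroup.
have Pt : P (aut_t 0) by split=> // m; apply: t_ray.
have t0_1 w : aut_t 0 (o1 :: w) = o1 :: w by rewrite t_1.
have tV0_1 w : (aut_t 0)^-1%g (o1 :: w) = o1 :: w by rewrite tV_1.
have E := (@aut_mulE 3, a3_0, a3_1, a3_2, aV3_0, aV3_1, aV3_2, t_0, t0_1, t_2,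
  tV_0, tV0_1, tV_2, aVK).
have Pata : P (aut_a 3 * aut_t 0 * (aut_a 3)^-1)%g.
  by apply: (@ray_stabilizerP _ _ _ 1%g) => // w; rewrite !E.
case/letter3P => ->; set S := sections P _.
  have sS : is_subgroup S by apply: sections_subgroup.
  have Sa : S (aut_a 3) by exists (aut_t 0) => // w; rewrite !E.
  split=> //; exists o2; apply: sections_recurrent => //.
  by eexists; first exact: Pata; move=> w; rewrite !E.
have sS : is_subgroup S by apply: sections_subgroup.
have Sa : S (aut_a 3) by eexists; first exact: Pata; move=> w; rewrite !E.
have SaV : S (aut_a 3)^-1%g by apply: (subgroupV sS).
have Stat : S (aut_t 0 * aut_a 3 * (aut_t 0)^-1)%g.
  exists (((aut_a 3)^-1 * aut_t 0 * aut_a 3) *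
     (aut_a 3 * aut_t 0 * (aut_a 3)^-1) *
     ((aut_a 3)^-1 * (aut_t 0)^-1 * aut_a 3))%g => [|w]; last by rewrite !E.
  apply: (@ray_stabilizerP _ _ _ 1%g) => // [|w]; last by rewrite !E.
  by do 2!apply: (subgroupM sH) => //.
have Stat' : S ((aut_t 0)^-1 * aut_a 3 * aut_t 0)%g.
  exists (((aut_a 3)^-1 * (aut_t 0)^-1 * aut_a 3) *
     (aut_a 3 * aut_t 0 * (aut_a 3)^-1) *
     ((aut_a 3)^-1 * aut_t 0 * aut_a 3))%g => [|w]; last by rewrite !E.
  apply: (@ray_stabilizerP _ _ _ 1%g) => // [|w]; last first.
    by rewrite !E (aut_VE (aut_a 3)) aut_funK.
  by do 2!apply: (subgroupM sH) => //.
split=> //; exists o2; apply: generated_sub; first exact: sections_subgroup.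
move=> _ [->|->].
- exists (aut_a 3 * ((aut_t 0)^-1 * aut_a 3 * aut_t 0) *
      (aut_a 3)^-1 * (aut_a 3)^-1)%g.
    by do 3!apply: (subgroupM sS) => //.
  by move=> w; rewrite !E.
- exists (aut_t 0 * aut_a 3 * (aut_t 0)^-1 * (aut_a 3)^-1)%g.
    exact: (subgroupM sS).
  by move=> w; rewrite !E.
Qed.

(** Here t = (a,a,t), with conjugates ata^-1 = (t,a,a) and a^-1ta = (a,t,a). The
   quotient of these two is (ta^-1, at^-1, 1), which fixes the ray; together with
   t it yields both generators below 0 and below 1. *)
Theorem gelfand_Gammabar (R : realType) n :
  gelfand_pair R Gammabar_group (level_stabilizer Gammabar_group o2 n).
Proof.
apply: gelfand_Gamma_type => y.
rewrite -[generated _]/Gammabar_group; set H := Gammabar_group.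
have sH : is_subgroup H by apply: generated_subgroup.
have [Ha Ht] : H (aut_a 3) /\ H (aut_t 1).
  by split; apply: sub_generated => /=; tauto.
set P := ray_stabilizer H o2.
have sP : is_subgroup P by apply: ray_stabilizer_subgroup.
have Pt : P (aut_t 1) by split=> // m; apply: t_ray.
have t1_1 w : aut_t 1 (o1 :: w) = o1 :: aut_a 3 w by rewrite t_1.
have tV1_1 w : (aut_t 1)^-1%g (o1 :: w) = o1 :: (aut_a 3)^-1%g w by rewrite tV_1.
have E := (@aut_mulE 3, a3_0, a3_1, a3_2, aV3_0, aV3_1, aV3_2, t_0, t1_1, t_2,
  tV_0, tV1_1, tV_2, aVK).
pose r := (aut_a 3 * aut_t 1 * (aut_a 3)^-1 *
  ((aut_a 3)^-1 * (aut_t 1)^-1 * aut_a 3))%g.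
have Pr : P r.
  apply: (@ray_stabilizerP _ _ _ 1%g) => // [|w]; last by rewrite !E.
  by do ?apply: (subgroupM sH) => //; apply: (subgroupV sH).
case/letter3P => ->; set S := sections P _.
  have sS : is_subgroup S by apply: sections_subgroup.
  have Sa : S (aut_a 3) by exists (aut_t 1) => // w; rewrite !E.
  split=> //; exists o2; apply: sections_recurrent => //.
  rewrite -[aut_t 1](mulgVK (aut_a 3)); apply: (subgroupM sS) => //.
  by exists r => // w; rewrite !E.
have sS : is_subgroup S by apply: sections_subgroup.
have Sa : S (aut_a 3) by exists (aut_t 1) => // w; rewrite !E.
split=> //; exists o2; apply: sections_recurrent => //.
rewrite -[aut_t 1]invgK; apply: (subgroupV sS).
rewrite -[(_^-1)%g](mulKg (aut_a 3)); apply: (subgroupM sS).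
  exact: (subgroupV sS).
by exists r => // w; rewrite !E.
Qed.

(** Here t = (a,a^2,t), with conjugates ata^-1 = (t,a,a^2) and a^-1ta = (a^2,t,a).
   Their product is (ta^2, at, 1), which fixes the ray. Below 1, the generator a is
   the section of t^2, as a^4 = a. *)
Theorem gelfand_Gammabarbar (R : realType) n :
  gelfand_pair R Gammabarbar_group (level_stabilizer Gammabarbar_group o2 n).
Proof.
apply: gelfand_Gamma_type => y.
rewrite -[generated _]/Gammabarbar_group; set H := Gammabarbar_group.
have sH : is_subgroup H by apply: generated_subgroup.
have [Ha Ht] : H (aut_a 3) /\ H (aut_t 2).
  by split; apply: sub_generated => /=; tauto.
set P := ray_stabilizer H o2.
have sP : is_subgroup P by apply: ray_stabilizer_subgroup.
have Pt : P (aut_t 2) by split=> // m; apply: t_ray.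
have t2_1 w : aut_t 2 (o1 :: w) = o1 :: aut_a 3 (aut_a 3 w) by rewrite t_1.
have E := (@aut_mulE 3, a3_0, a3_1, a3_2, aV3_0, aV3_1, aV3_2, t_0, t2_1, t_2,
  a3_cubed).
pose r := (aut_a 3 * aut_t 2 * (aut_a 3)^-1 *
  ((aut_a 3)^-1 * aut_t 2 * aut_a 3))%g.
have Pr : P r.
  apply: (@ray_stabilizerP _ _ _ 1%g) => // [|w]; last by rewrite !E.
  by do ?apply: (subgroupM sH) => //; apply: (subgroupV sH).
case/letter3P => ->; set S := sections P _.
  have sS : is_subgroup S by apply: sections_subgroup.
  have Sa : S (aut_a 3) by exists (aut_t 2) => // w; rewrite !E.
  split=> //; exists o2; apply: sections_recurrent => //.
  rewrite -[aut_t 2](mulgK (aut_a 3 * aut_a 3)%g); apply: (subgroupM sS).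
    by exists r => // w; rewrite !E.
  by apply: (subgroupV sS); apply: (subgroupM sS).
have sS : is_subgroup S by apply: sections_subgroup.
have Sa : S (aut_a 3).
  by exists (aut_t 2 * aut_t 2)%g => [|w]; [exact: (subgroupM sP)|rewrite !E].
split=> //; exists o2; apply: sections_recurrent => //.
rewrite -[aut_t 2](mulKg (aut_a 3)); apply: (subgroupM sS).
  exact: (subgroupV sS).
by exists r => // w; rewrite !E.
Qed.

End Ternary.

(** * The Gelfand pairs *)

(* The letters 1 of {0,1} and 2 of {0,1,2} are the respective ord_max. *)
Theorem proposition9p17 (R : realType) (n : nat) :
  [/\ gelfand_pair R G_group (level_stabilizer G_group (@ord_max 1) n),
      gelfand_pair R Gtilde_group
        (level_stabilizer Gtilde_group (@ord_max 1) n),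
      gelfand_pair R Gamma_group
        (level_stabilizer Gamma_group (@ord_max 2) n),
      gelfand_pair R Gammabar_group
        (level_stabilizer Gammabar_group (@ord_max 2) n) &
      gelfand_pair R Gammabarbar_group
        (level_stabilizer Gammabarbar_group (@ord_max 2) n)].
Proof.
split; [exact: gelfand_G | exact: gelfand_Gtilde | exact: gelfand_Gamma
  | exact: gelfand_Gammabar | exact: gelfand_Gammabarbar].
Qed.
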